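(* Every infinite subset $M$ of $\ell_1$, viewed as a metric space with the metric inherited from the norm of $\ell_1$, has the strong long trapezoid property.
   Context: $\ell_1$ is the real Banach space of absolutely summable real sequences with norm $\|x\|=\sum_i|x_i|$. A metric space $M$ with metric $d$ has the strong long trapezoid property if, for every finite subset $N$ of $M$ and every $\varepsilon>0$, there exist $u,v\in M$, $u\neq v$, such that for all $x,y\in N$ $$(1-\varepsilon)\bigl(d(x,y)+d(u,v)\bigr)\le d(x,u)+d(y,v),$$ and for all $x,y,z,w\in N$ $$(1-\varepsilon)\bigl(2d(u,v)+d(x,y)+d(z,w)\bigr)\le d(x,u)+d(y,u)+d(z,v)+d(w,v).$$ *)

(* Defs.v *)
From HB Require Import structures.
From mathcomp Require Import all_boot all_order all_algebra.
From mathcomp Require Import all_classical all_reals all_analysis.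

Set Implicit Arguments.
Unset Strict Implicit.
Unset Printing Implicit Defensive.

Import Order.TTheory GRing.Theory Num.Theory.
Import numFieldNormedType.Exports.

Local Open Scope classical_set_scope.
Local Open Scope ring_scope.

(* [normed series u] is the sequence of the partial sums of the |u_i|. *)
Definition abs_summable (R : realType) : {pred nat -> R} :=
  fun u => `[< cvgn [normed series u] >].
Arguments abs_summable : clear implicits.

Section abs_summable_submod.
Variable R : realType.
Implicit Types u v : nat -> R.

Lemma abs_summableP u :
  reflect (cvgn [normed series u]) (u \in abs_summable R).
Proof. exact: asboolP. Qed.

Lemma normed_seriesZ (a : R) u :
  [normed series (a *: u)] = series (`|a| *: (fun n => `|u n|)).
Proof.
by apply/funext => n; apply: eq_bigr => i _; rewrite /= normrM.
Qed.

Lemma abs_summable0 : 0 \in abs_summable R.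
Proof.
apply/abs_summableP.
have -> : [normed series (0 : nat -> R)] = cst 0.
  by apply/funext => n; rewrite /= /series/= big1// => i _; rewrite normr0.
exact: is_cvg_cst.
Qed.

Lemma abs_summableD : {in abs_summable R &, forall u v,
  u + v \in abs_summable R}.
Proof.
move=> u v /abs_summableP cu /abs_summableP cv; apply/abs_summableP.
apply: (@series_le_cvg _ (fun n => `|u n + v n|) (fun n => `|u n| + `|v n|)).
- by move=> n; exact: normr_ge0.
- by move=> n; rewrite addr_ge0.
- by move=> n; exact: ler_normD.
- exact: is_cvg_seriesD cu cv.
Qed.

Lemma abs_summableZ (a : R) :
  {in abs_summable R, forall u, a *: u \in abs_summable R}.
Proof.
move=> u /abs_summableP cu; apply/abs_summableP.
by rewrite normed_seriesZ; exact: is_cvg_seriesZ.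
Qed.

Lemma abs_summable_submod_closed : submod_closed (abs_summable R).
Proof.
split; first exact: abs_summable0.
by move=> a u v su sv; rewrite abs_summableD// abs_summableZ.
Qed.

HB.instance Definition _ :=
  GRing.isSubmodClosed.Build R (nat -> R) (abs_summable R)
    abs_summable_submod_closed.

End abs_summable_submod.

Record ell1 (R : realType) :=
  Ell1 { ell1_val :> nat -> R; _ : ell1_val \in abs_summable R }.

Section ell1_normed.
Variable R : realType.

HB.instance Definition _ := [isSub for @ell1_val R].
HB.instance Definition _ := [Choice of ell1 R by <:].
HB.instance Definition _ := [SubChoice_isSubLmodule of ell1 R by <:].

Implicit Types x y : ell1 R.

Lemma ell1_is_cvg x : cvgn [normed series x].
Proof. exact/abs_summableP/valP. Qed.

Definition ell1_norm x : R := limn [normed series x].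

Lemma ell1_partial_le x n : \sum_(0 <= i < n) `|x i| <= ell1_norm x.
Proof.
apply: (nondecreasing_cvgn_le _ (@ell1_is_cvg x)).
by apply: nondecreasing_series => i _ _; exact: normr_ge0.
Qed.

Lemma ell1_norm_le x (e : R) :
  (forall n, \sum_(0 <= i < n) `|x i| <= e) -> ell1_norm x <= e.
Proof.
by move=> xe; apply: limr_le; [exact: ell1_is_cvg|exact: nearW].
Qed.

Lemma ell1_normD x y : ell1_norm (x + y) <= ell1_norm x + ell1_norm y.
Proof.
apply: ell1_norm_le => n.
apply: (le_trans _ (lerD (ell1_partial_le x n) (ell1_partial_le y n))).
by rewrite -big_split; apply: ler_sum => i _; exact: ler_normD.
Qed.

Lemma ell1_normZ (a : R) x : ell1_norm (a *: x) = `|a| * ell1_norm x.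
Proof.
rewrite /ell1_norm [X in limn X](_ : _ = [normed series (a *: (x : nat -> R))])//.
by rewrite normed_seriesZ lim_seriesZ//; exact: ell1_is_cvg.
Qed.

Lemma ell1_coord_le x i : `|x i| <= ell1_norm x.
Proof.
apply: (le_trans _ (ell1_partial_le x i.+1)).
by rewrite big_nat_recr//= lerDr sumr_ge0.
Qed.

Lemma ell1_norm_eq0 x : ell1_norm x = 0 -> x = 0.
Proof.
move=> x0; apply/val_inj/funext => i; apply/eqP.
by rewrite -normr_le0 -x0 ell1_coord_le.
Qed.

HB.instance Definition _ := @Lmodule_isNormed.Build R (ell1 R) ell1_norm
  ell1_normD ell1_normZ ell1_norm_eq0.

Lemma ell1_normE x : `|x| = limn [normed series x].
Proof. by []. Qed.

Lemma ell1_complete (F : set_system (ell1 R)) :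
  ProperFilter F -> cauchy F -> cvg F.
Proof.
move=> FF /cauchy_ballP Fc.
have {}Fc (e : R) : 0 < e -> exists2 x, F (fun y => `|x - y| < e) &
    F (fun x => F (fun y => `|x - y| < e)).
  move=> e0; have := Fc _ e0; rewrite -ball_normE /ball_/= => Fe.
  have {}Fe : F (fun x => F (fun y => `|x - y| < e)).
    exact: (@nearP_dep _ _ F F).
  by have [x Fx] := filter_ex Fe; exists x.
have cF i : cvg ((fun x : ell1 R => x i) @ F).
  apply: R_complete; apply/cauchy_exP => e /Fc[x Fx _]; exists (x i).
  rewrite /nbhs/=; apply: filterS Fx => y xy.
  by apply: le_lt_trans xy; exact: (ell1_coord_le (x - y)).
pose l i : R := lim ((fun x : ell1 R => x i) @ F).
have close (e : R) (x : ell1 R) : F (fun y => `|x - y| < e) ->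
    forall n, \sum_(0 <= i < n) `|x i - l i| <= e.
  move=> Fx n.
  have cs : (fun y : ell1 R => \sum_(0 <= i < n) `|x i - y i|) @ F -->
      \sum_(0 <= i < n) `|x i - l i|.
    elim: n => [|n IHn].
      by rewrite big_geq//; under eq_fun do rewrite big_geq//; exact: cvg_cst.
    rewrite big_nat_recr//=; under eq_fun do rewrite big_nat_recr//=.
    apply: cvgD => //; apply: cvg_norm; apply: cvgB; first exact: cvg_cst.
    exact: cF.
  rewrite -(cvg_lim _ cs)//; apply: limr_le; first by apply/cvg_ex; eexists; exact: cs.
  near=> y; apply: (le_trans (ell1_partial_le (x - y) n)).
  by apply/ltW; near: y.
have lS : l \in abs_summable R.
  have [x Fx _] := Fc _ ltr01.
  have xlS : (x : nat -> R) - l \in abs_summable R.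
    apply/abs_summableP/nondecreasing_is_cvgn.
      by apply: nondecreasing_series => i _ _; exact: normr_ge0.
    by exists 1 => _ [n _ <-]; exact: close Fx n.
  have -> : l = (x : nat -> R) - ((x : nat -> R) - l).
    by rewrite opprB addrC subrK.
  by rewrite rpredB//; exact: valP.
apply/cvg_ex; exists (Ell1 lS); apply/cvgrPdist_le => e e0.
have [_ _] := Fc _ e0; apply: filterS => x Fx.
by rewrite distrC; apply: ell1_norm_le => n; exact: close Fx n.
Unshelve. all: by end_near. Qed.

HB.instance Definition _ := Uniform_isComplete.Build (ell1 R) ell1_complete.

End ell1_normed.

Section ell1_metric.
Variable R : realType.
Let dist (x y : ell1 R) : R := `|x - y|.

Let dist_ge0 x y : 0 <= dist x y. Proof. exact: normr_ge0. Qed.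

Let dist_positivity x y : dist x y = 0 -> x = y.
Proof. by move/normr0_eq0/eqP; rewrite subr_eq0 => /eqP. Qed.

Let ballEdist x d : ball x d = [set y | dist x y < d].
Proof. by rewrite -ball_normE. Qed.

HB.instance Definition _ := @PseudoMetric_isMetric.Build R (ell1 R)
  dist dist_ge0 dist_positivity ballEdist.

Lemma ell1_mdistE (x y : ell1 R) : mdist x y = `|x - y|.
Proof. by []. Qed.

End ell1_metric.

(* A subset A, seen as the type set_type A (elements of X bundled with a proof
   of membership in A), carries the metric inherited from X; it is compatible
   with the pseudometric structure that set_type A already has. *)
Section subset_metric.
Context {R : realType} {X : metricType R} (A : set X).

Let dist (x y : A) : R := mdist (\val x) (\val y).

Let dist_ge0 x y : 0 <= dist x y. Proof. exact: mdist_ge0. Qed.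

Let dist_positivity x y : dist x y = 0 -> x = y.
Proof. by move=> xy; apply/val_inj/mdist_positivity. Qed.

Let ballEdist (x : A) (d : R) : ball x d = [set y | dist x y < d].
Proof.
by rewrite [LHS](_ : _ = [set y | ball (\val x) d (\val y)])// ballEmdist.
Qed.

HB.instance Definition _ := @PseudoMetric_isMetric.Build R (set_type A)
  dist dist_ge0 dist_positivity ballEdist.

Lemma set_type_mdistE (x y : A) : mdist x y = mdist (\val x) (\val y).
Proof. by []. Qed.

End subset_metric.

Definition strong_long_trapezoid_property (R : realType) (M : metricType R) :=
  forall (N : set M) (eps : R), finite_set N -> 0 < eps ->
  exists u v : M,
    [/\ u <> v,
        forall x y, N x -> N y ->
          (1 - eps) * (mdist x y + mdist u v) <= mdist x u + mdist y v
      & forall x y z w, N x -> N y -> N z -> N w ->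
          (1 - eps) * (2 * mdist u v + mdist x y + mdist z w)
            <= mdist x u + mdist y u + mdist z v + mdist w v].

(* Main.v *)
Require Import Defs.
From mathcomp Require Import all_boot all_order all_algebra.
From mathcomp Require Import all_classical all_reals all_analysis.
From mathcomp Require Import lra.

Set Implicit Arguments.
Unset Strict Implicit.

Import Order.TTheory GRing.Theory Num.Theory numFieldNormedType.Exports.

Local Open Scope classical_set_scope.
Local Open Scope ring_scope.

(** Each of three situations yields the property.

    If M is unbounded, take u fixed and v very far away: the distances that do
    not involve v, and the differences between d(u,v) and the distances d(y,v)
    for y in the finite set, are negligible against d(u,v)
    ([trapezoid_unbounded]).

    If M contains pairs of distinct points at arbitrarily small distance, take
    such a pair u, v, so that d(u,v) is negligible against the positive
    distances in the finite set ([trapezoid_close_points]).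

    If M is infinite and bounded, fix an ultrafilter F on M finer than the cofinite filter.
    Along F the points u of M converge coordinatewise to some l, which lies in
    l1 by Fatou but need not lie in M, and |l - u| converges to some r >= 0.  In
    l1, a coordinatewise null net is asymptotically disjoint from any fixed
    vector, so that |a - u| - |l - u| tends to |a - l|
    ([ell1_norm_cvgB]).  If r = 0, then u tends to l in norm, and since F
    contains no finite set, M has arbitrarily close distinct points.  If r > 0,
    put h x = |x - l|.  For u and then v far along F, the distances d(x,u) and
    d(y,v) are almost h x + r and h y + r while d(u,v) is almost 2 r, and both
    inequalities follow from d(x,y) <= h x + h y
    ([trapezoid_additive_limit]).

    Using an ultrafilter replaces the successive extractions of subsequences:
    every bounded real function on M has a limit along F. *)

(** * Sufficient conditions in a metric space *)

(** An additive error t is harmless as soon as it is small compared with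
    d(u,v), because the factor 1 - eps takes eps d(u,v) off the left-hand side
    of the first inequality and twice that off the second. *)
Lemma trapezoid_of_slack (R : realType) (M : metricType R) :
  (forall (N : set M) (eps : R), finite_set N -> 0 < eps ->
    exists (u v : M) (t : R),
    [/\ u <> v, t <= eps * mdist u v,
        forall x y, N x -> N y ->
          mdist x y + mdist u v <= mdist x u + mdist y v + t
      & forall x y z w, N x -> N y -> N z -> N w ->
          2 * mdist u v + mdist x y + mdist z w
            <= mdist x u + mdist y u + mdist z v + mdist w v + 2 * t]) ->
  strong_long_trapezoid_property M.
Proof.
move=> slack N eps finN eps0.
have [u [v [t [uv teps tr1 tr2]]]] := slack N eps finN eps0.
exists u, v; split=> // [x y Nx Ny|x y z w Nx Ny Nz Nw].
- have := tr1 x y Nx Ny.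
  have : 0 <= eps * mdist x y by rewrite mulr_ge0// ?mdist_ge0// ltW.
  lra.
- have := tr2 x y z w Nx Ny Nz Nw.
  have : 0 <= eps * mdist x y by rewrite mulr_ge0// ?mdist_ge0// ltW.
  have : 0 <= eps * mdist z w by rewrite mulr_ge0// ?mdist_ge0// ltW.
  lra.
Qed.

Lemma finite_set_ubound (R : realType) (T : Type) (N : set T) (f : T -> R) :
  finite_set N -> exists2 C, 0 <= C & forall x, N x -> f x <= C.
Proof.
move=> finN.
have : finite_set [set f x | x in N] by exact: finite_image.
move/finite_seqP => [s sE].
exists (\sum_(y <- s) `|y|); first by rewrite sumr_ge0.
move=> x Nx; have : f x \in s.
  have : [set f x | x in N] (f x) by exists x.
  by rewrite sE.
elim: s {sE} => // y s IHs; rewrite inE big_cons => /orP[/eqP <-|/IHs fs].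
  by rewrite (le_trans (ler_norm _))// lerDl sumr_ge0.
by rewrite (le_trans fs)// lerDr.
Qed.

(** With u = p and C bounding the distances from p to N, the two inequalities
    hold up to the errors 3 C and 6 C. *)
Lemma trapezoid_unbounded (R : realType) (M : metricType R) (p : M) :
  (forall K : R, exists v, K < mdist p v) -> strong_long_trapezoid_property M.
Proof.
move=> far; apply: trapezoid_of_slack => N eps finN eps0.
have [C C0 Cub] := finite_set_ubound (mdist p) finN.
have [v pv] := far (3 * C / eps).
exists p, v, (3 * C).
have tri x : N x -> mdist p v <= C + mdist x v.
  by move=> /Cub xC; rewrite (le_trans (metric_triangle _ x _))// lerD2r.
have diam x y : N x -> N y -> mdist x y <= C + C.
  move=> /Cub xC /Cub yC; rewrite (le_trans (metric_triangle _ p _))// lerD//.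
  by rewrite metric_sym.
split=> [pvE|||].
- move: pv; rewrite -pvE mdistxx ltNge => /negP; apply.
  by rewrite divr_ge0 ?mulr_ge0 ?(ltW eps0)//.
- by rewrite [leRHS]mulrC -ler_pdivrMr// ltW.
- move=> x y Nx Ny; have := diam x y Nx Ny; have := tri y Ny.
  have := mdist_ge0 x p; lra.
- move=> x y z w Nx Ny Nz Nw; have := diam x y Nx Ny; have := diam z w Nz Nw.
  have := tri z Nz; have := tri w Nw.
  have := mdist_ge0 x p; have := mdist_ge0 y p; lra.
Qed.

Lemma finite_set_separated (R : realType) (M : metricType R) (N : set M) :
  finite_set N ->
  exists2 D : R, 0 < D & forall x y, N x -> N y -> x <> y -> D <= mdist x y.
Proof.
move=> finN.
have [C C0 Cub] := finite_set_ubound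
  (fun xy => (mdist xy.1 xy.2)^-1) (finite_setX finN finN).
exists (C + 1)^-1 => [|x y Nx Ny /eqP xy]; first by rewrite invr_gt0; lra.
have d0 : 0 < mdist x y by rewrite mdist_gt0.
rewrite -[leRHS]invrK lef_pV2 ?posrE ?invr_gt0//; last by lra.
by have /= := Cub (x, y) (conj Nx Ny); lra.
Qed.

(** When two of the points of N involved are distinct, say at distance d, the
    triangle inequality loses a multiple of d(u,v), which is absorbed once
    d(u,v) is small against d and eps d; when all of them coincide, the inequalities are instances of the triangle
    inequality d(u,v) <= d(x,u) + d(x,v). *)
Lemma trapezoid_close_points (R : realType) (M : metricType R) :
  (forall e : R, 0 < e -> exists u v : M, u <> v /\ mdist u v < e) ->
  strong_long_trapezoid_property M.
Proof.
move=> close N eps finN eps0.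
have [D D0 sep] := finite_set_separated finN.
(* The bound by eps serves to absorb d(u,v) into eps d(x,y); the bound by 1
   serves the case x = y, z = w with x and z distinct, where a small d(u,v) is
   needed even if eps is large. *)
pose k := Num.min eps 1.
have k0 : 0 < k by rewrite lt_min eps0 ltr01.
have [u [v [uv duv]]] := close (k * D / 2) ltac:(by rewrite divr_gt0 ?mulr_gt0).
have d0 : 0 <= mdist u v by exact: mdist_ge0.
have epsD (x y : M) : N x -> N y -> x <> y -> 2 * mdist u v <= eps * mdist x y.
  move=> Nx Ny xy; have Dxy := sep x y Nx Ny xy.
  have : k * D <= eps * mdist x y.
    by apply: ler_pM => //; [exact: ltW|exact: ltW|rewrite ge_min lexx].
  lra.
have smallD (x y : M) : N x -> N y -> x <> y -> 2 * mdist u v <= mdist x y.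
  move=> Nx Ny xy; have Dxy := sep x y Nx Ny xy.
  have : k * D <= 1 * mdist x y.
    by apply: ler_pM => //; [exact: ltW|exact: ltW|rewrite ge_min lexx orbT].
  lra.
have eps_ge0 (x y : M) : 0 <= eps * mdist x y.
  by rewrite mulr_ge0 ?mdist_ge0// ltW.
have tri (p x y : M) : mdist x y <= mdist x p + mdist y p.
  by rewrite (metric_sym y) metric_triangle.
have tri4 (x y : M) : mdist x y <= mdist x u + mdist u v + mdist y v.
  rewrite (le_trans (tri v x y))// lerD2r//; exact: metric_triangle.
have triuv (x : M) : mdist u v <= mdist x u + mdist x v.
  by rewrite (metric_sym x u) metric_triangle.
exists u, v; split=> // [x y Nx Ny|x y z w Nx Ny Nz Nw].
- have [<-|/eqP xy] := eqVneq x y.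
    rewrite mdistxx; have := triuv x; have := eps_ge0 u v; lra.
  have := epsD x y Nx Ny xy; have := tri4 x y; have := eps_ge0 u v; lra.
- have := eps_ge0 u v; have := eps_ge0 x y; have := eps_ge0 z w.
  have := tri u x y; have := tri v z w.
  have [<-|/eqP xy] := eqVneq x y; last first.
    have := epsD x y Nx Ny xy; lra.
  have [<-|/eqP zw] := eqVneq z w; last first.
    have := epsD z w Nz Nw zw; lra.
  rewrite !mdistxx.
  have [<-|/eqP xz] := eqVneq x z.
    have := triuv x; lra.
  have := smallD x z Nx Nz xz; have := tri4 x z; lra.
Qed.

Lemma near_finite_set (T : Type) (U : choiceType) (F : set_system T)
    (N : set U) (P : U -> T -> Prop) : Filter F -> finite_set N ->
  (forall x, N x -> \forall u \near F, P x u) ->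
  \forall u \near F, forall x, N x -> P x u.
Proof.
move=> FF /finite_fsetP[D ->] DP.
by apply: filterS (filter_bigI FF DP) => u Pu x Dx; exact: Pu.
Qed.

(** The function h plays the role of the distance to a virtual point that every
    u close to F sees at distance r, in a direction independent of all points
    of M fixed beforehand; two such points u, v chosen one after the other are
    then at distance about 2 r. *)
Lemma trapezoid_additive_limit (R : realType) (M : metricType R) (F : set_system M)
    (h : M -> R) (r : R) :
  ProperFilter F -> 0 < r -> (forall x y, mdist x y <= h x + h y) ->
  (forall x, mdist x u @[u --> F] --> h x + r) -> h u @[u --> F] --> r ->
  strong_long_trapezoid_property M.
Proof.
move=> FF r0 dh dcvg hcvg; apply: trapezoid_of_slack => N eps finN eps0.
(* The errors on the distances add up to 4 eta, and d(u,v) > 2 r - 2 eta; this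
   eta solves 4 eta = eps (2 r - 2 eta). *)
pose eta := eps * r / (2 + eps).
have eta0 : 0 < eta by rewrite divr_gt0 ?mulr_gt0//; lra.
have etaE : eta * (2 + eps) = eps * r by rewrite divfK//; lra.
have eta_r : eta < r.
  by rewrite ltr_pdivrMr ?(addr_gt0, ltr0n)// mulrC ltr_pM2l// ltrDr ltr0n.
have near_d x : \forall u \near F, `|mdist x u - (h x + r)| < eta.
  exact: cvgr_distC_lt (dcvg x) _ eta0.
have near_N : \forall u \near F,
    forall x, N x -> `|mdist x u - (h x + r)| < eta.
  exact: near_finite_set.
have [u [Nu hu]] := filter_ex (filterI near_N (cvgr_distC_lt _ _ hcvg _ eta0)).
have [v [Nv uv]] := filter_ex (filterI near_N (near_d u)).
have {}Nu x : N x -> h x + r - eta < mdist x u.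
  by move=> /Nu; rewrite ltr_distl => /andP[].
have {}Nv x : N x -> h x + r - eta < mdist x v.
  by move=> /Nv; rewrite ltr_distl => /andP[].
move: hu uv; rewrite !ltr_distl => /andP[hu1 hu2] /andP[uv1 uv2].
exists u, v, (4 * eta); split=> [uvE|||].
- by move: uv1; rewrite uvE mdistxx -uvE; lra.
- have : eps * (2 * r - 2 * eta) <= eps * mdist u v by rewrite ler_pM2l//; lra.
  lra.
- move=> x y Nx Ny; have := Nu x Nx; have := Nv y Ny; have := dh x y; lra.
- move=> x y z w Nx Ny Nz Nw; have := Nu x Nx; have := Nu y Ny.
  have := Nv z Nz; have := Nv w Nw; have := dh x y; have := dh z w; lra.
Qed.

(** * Limits along an ultrafilter and the norm of l1 *)

Lemma bounded_ultra_cvg (R : realType) (T : Type) (F : set_system T)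
    (f : T -> R) (B : R) : UltraFilter F -> (forall t, `|f t| <= B) ->
  exists l : R, f t @[t --> F] --> l.
Proof.
move=> FU fB.
have inB : (f t @[t --> F]) `[- B, B]%classic.
  by apply: (@nearW _ F) => t /=; rewrite in_itv/= -ler_norml.
have [l [_ lF]] := @segment_compact R _ _ _ (fmap_proper_filter f _) inB.
exists l; apply/cvgrPdist_lt => e e0.
have [//|far] := in_ultra_setVsetC [set t | `|l - f t| < e] FU.
have [y [/= yfar ybal]] := lF [set y | ~ (`|l - y| < e)] (ball l e) far
  (nbhsx_ballx l e e0).
by move: ybal; rewrite -ball_normE.
Qed.

(** The norm is additive on disjoint supports, and c and w are almost so when w
    is small on the first k coordinates and c is small on the others: a
    coordinate contributes to |c| + |w| - |c - w| at most twice the smaller of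
    |c_i| and |w_i|. *)
Lemma ell1_norm_almost_additive (R : realType) (c w : ell1 R) (k : nat) :
  `|c| + `|w| <= `|c - w| + 2 * \sum_(0 <= i < k) `|w i|
                 + 2 * (`|c| - \sum_(0 <= i < k) `|c i|).
Proof.
rewrite -lerBrDl; apply: ell1_norm_le => n.
apply: (@le_trans _ _ (\sum_(0 <= i < k + n) `|w i|)).
  rewrite addnC [leRHS](big_cat_nat (n := n))//= ?leq_addr//.
  by rewrite lerDl sumr_ge0.
have c_le := ell1_partial_le c (k + n).
have cw_le := ell1_partial_le (c - w) (k + n).
have head : \sum_(0 <= i < k) `|c i| <=
    \sum_(0 <= i < k) `|w i| + \sum_(0 <= i < k) `|(c - w) i|.
  rewrite -big_split; apply: ler_sum => i _ /=.
  by rewrite -[c i](subrK (w i)) addrC ler_normD.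
have tail : \sum_(k <= i < k + n) `|w i| <=
    \sum_(k <= i < k + n) `|c i| + \sum_(k <= i < k + n) `|(c - w) i|.
  rewrite -big_split; apply: ler_sum => i _ /=.
  by rewrite -[X in `|X| <= _](subKr (c i)) ler_normB.
move: c_le cw_le; rewrite !(@big_cat_nat _ _ _ k 0 (k + n))//= ?leq_addr//.
rewrite -[ell1_norm c]/(`|c|) -[ell1_norm (c - w)]/(`|c - w|); lra.
Qed.

(** The coordinatewise limit is absolutely summable because its partial sums of
    absolute values are limits of partial sums bounded by B. *)
Lemma ell1_coordinatewise_limit (R : realType) (T : Type) (F : set_system T)
    (x : T -> ell1 R) (B : R) : UltraFilter F -> (forall t, `|x t| <= B) ->
  exists l : ell1 R, forall i, x t i @[t --> F] --> l i.
Proof.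
move=> FU xB.
have /choice[l lF] : forall i, exists l : R, x t i @[t --> F] --> l.
  move=> i; apply: (@bounded_ultra_cvg R T F _ B) => t.
  exact: le_trans (ell1_coord_le _ _) (xB t).
suff lS : l \in abs_summable R by exists (Ell1 lS).
apply/abs_summableP/nondecreasing_is_cvgn.
  by apply: nondecreasing_series => i _ _; exact: normr_ge0.
exists B => _ [n _ <-].
have sums : \sum_(0 <= i < n) `|x t i| @[t --> F] --> \sum_(0 <= i < n) `|l i|.
  by apply: cvg_big => [|i _]; [exact: add_continuous|exact: cvg_norm].
rewrite -[leLHS]/(\sum_(0 <= i < n) `|l i|) -(cvg_lim _ sums)//.
apply: limr_le.
  by apply/cvg_ex; eexists; exact: sums.
by apply: nearW => t; exact: le_trans (ell1_partial_le _ _) (xB t).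
Qed.

(** When x t tends to l coordinatewise, the part of x t - l that does not vanish
    in norm escapes to coordinates on which the fixed vector a - l is negligible,
    so the norms of the two vectors add up.  This is the property of l1 on which
    the theorem rests. *)
Lemma ell1_norm_cvgB (R : realType) (T : Type) (F : set_system T)
    (x : T -> ell1 R) (l a : ell1 R) :
  ProperFilter F -> (forall i, x t i @[t --> F] --> l i) ->
  `|a - x t| - `|l - x t| @[t --> F] --> `|a - l|.
Proof.
move=> FF xl; apply/cvgrPdist_le => e e0.
have tail0 : \forall k \near \oo, `|a - l| - \sum_(0 <= i < k) `|(a - l) i| < e / 4.
  have := cvgr_dist_lt _ _ (@ell1_is_cvg R (a - l)) (e / 4) ltac:(lra).
  apply: filterS => k; rewrite ltr_distl -ell1_normE => /andP[_]; by rewrite -ltrBlDl.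
(* Cut at an index k beyond which a - l is negligible; below it, x t - l is
   negligible along F as a finite sum of null coordinates. *)
have [k k_tail] := filter_ex tail0.
have head0 : \sum_(0 <= i < k) `|x t i - l i| @[t --> F] --> (0 : R).
  rewrite -[X in _ --> X](_ : \sum_(0 <= i < k) `|l i - l i| = 0); last first.
    by rewrite big1// => i _; rewrite subrr normr0.
  apply: cvg_big => [|i _]; first exact: add_continuous.
  by apply: cvg_norm; apply: cvgB => //; exact: cvg_cst.
have := cvgr_lt _ head0 (e / 4) ltac:(lra).
apply: filterS => t head_t.
have := ell1_norm_almost_additive (a - l) (x t - l) k.
have -> : a - l - (x t - l) = a - x t by rewrite opprB addrA subrK.
have := ler_normD (a - l) (l - x t).
rewrite addrA subrK (distrC (x t) l) ler_norml => up low.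
by move: k_tail head_t; rewrite /= => k_tail head_t; apply/andP; split; lra.
Qed.

(** * Infinite subsets of l1 *)

Theorem mainTheorem4 (R : realType) (M : set (ell1 R)) :
  infinite_set M -> strong_long_trapezoid_property (set_type M).
Proof.
move=> infM.
have [p0 Mp0] := infinite_setN0 infM.
pose p : M := SigSub (mem_set Mp0).
have [far|] := pselect (forall K : R, exists v : M, K < mdist p v).
  exact: trapezoid_unbounded far.
move=> /existsNP[K /forallNP near_p].
have bounded (u : M) : `|\val u| <= `|\val p| + K.
  have := near_p u; move/negP; rewrite -leNgt set_type_mdistE ell1_mdistE => pu.
  rewrite -[\val u](subKr (\val p)) (le_trans (ler_normB _ _))// lerD2l//.
pose cofinite : set_system M := [set A | cofinite_set A].
have cofiniteP : ProperFilter cofinite.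
  split; last split.
  - rewrite /cofinite/= setC0 => finM; apply: infM.
    have -> : M = [set \val u | u in [set: M]].
      apply/seteqP; split=> [x Mx|_ [u _ <-]]; last exact: set_valP.
      by exists (SigSub (mem_set Mx)).
    exact: finite_image.
  - exact: cofinite_setT.
  - by move=> A C; rewrite /cofinite/= setCI => finA finC; rewrite finite_setU.
  - by move=> A C AC; exact: sub_cofinite_set.
have [F [FU cofF]] := ultraFilterLemma cofiniteP.
have [l xl] := ell1_coordinatewise_limit FU bounded.
pose h (u : M) : R := `|l - \val u|.
have h_bounded (u : M) : `|h u| <= `|l| + (`|\val p| + K).
  by rewrite normr_id (le_trans (ler_normB _ _))// lerD2l.
have [r hr] := bounded_ultra_cvg FU h_bounded.
have dh (x y : M) : mdist x y <= h x + h y.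
  by rewrite set_type_mdistE ell1_mdistE (le_trans (ler_distD l _ _))// (distrC _ l).
have : 0 <= r.
  rewrite -(cvg_lim _ hr)//; apply: limr_ge; last by apply: nearW => u; exact: normr_ge0.
  by apply/cvg_ex; exists r.
rewrite le_eqVlt => /predU1P[r0|r0].
  apply: trapezoid_close_points => e e0.
  have hsmall := cvgr_lt _ hr (e / 2) ltac:(lra).
  have [u hu] := filter_ex hsmall.
  have Fu : F (~` [set u]) by apply: cofF; rewrite /cofinite/= setCK.
  have [v [hv vu]] := filter_ex (filterI hsmall Fu).
  exists u, v; split; first by move=> uv; apply: vu.
  have := dh u v; move: hu hv => /=; lra.
apply: (@trapezoid_additive_limit _ _ F h r) => // x.
have -> : (fun u : M => mdist x u) = (fun u => (`|\val x - \val u| - h u) + h u).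
  by apply/funext => u; rewrite subrK.
rewrite /h distrC; apply: cvgD => //; exact: ell1_norm_cvgB.
Qed.
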